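(* Let $\langle X,d\rangle$ be an $\mathbb{R}$-tree and let $\kappa$ be an uncountable cardinal. The following are equivalent: (1) $X$ is $\kappa$-separable and has fewer than $\kappa$ many noncut-points; (2) for every $p\in X$, the cut-point order on $X$ with root $p$ is $\kappa$-wispy and has fewer than $\kappa$ many terminal nodes; (3) for every $p\in X$, the cut-point order on $X$ with root $p$ is $\kappa$-cc.
   Context: An $\mathbb{R}$-tree is a metric space $\langle X,d\rangle$ such that between any two points $x,y$ there is a unique arc (image of a topological embedding of a real interval $[a,b]$ sending $a\mapsto x$, $b\mapsto y$), denoted $[x,y]$, and this arc is the image of an isometric embedding. The cut-point order with root $p$ is defined by $x\le y$ iff $[p,x]\subseteq[p,y]$. A space is $\kappa$-separable if it has a dense subset of size less than $\kappa$. A noncut-point of a connected space $X$ is a point $x$ with $X\setminus\{x\}$ connected. For $x$ in a tree order, the $x$-connected components are the equivalence classes of $\{y\mid y>x\}$ under $y\sim_x z$ iff there is $w>x$ with $w\le y,z$; $x$ is terminal if there are none, and branching if there is more than one. A twig is a maximal upwards-closed subset order-isomorphic to a non-trivial real interval. The order is $\kappa$-wispy if it has fewer than $\kappa$ branching nodes and fewer than $\kappa$ twigs. An antichain is a set of pairwise incomparable elements; a tree order is $\kappa$-cc if it has no antichain of size $\kappa$. *)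

(* Defs.v *)
From mathcomp Require Import all_boot all_order all_algebra.
From mathcomp Require Import all_classical all_reals all_analysis.

Set Implicit Arguments.
Unset Strict Implicit.
Unset Printing Implicit Defensive.

Import Order.TTheory GRing.Theory Num.Theory.
Import numFieldNormedType.Exports.

Local Open Scope classical_set_scope.
Local Open Scope ring_scope.
Local Open Scope card_scope.

(* Cardinals are represented by types [K]: a set [A] has fewer than [|K|]
   elements when it injects into [K] but [K] does not inject into [A]. *)
Definition card_lt T U (A : set T) (B : set U) : Prop :=
  (A #<= B) /\ ~ (B #<= A).

Section TreeOrder.
Context {X : Type} (le : X -> X -> Prop).

Let lt x y := le x y /\ x <> y.

Definition above (x : X) : set X := [set y | lt x y].

Definition same_component (x y z : X) : Prop :=
  exists w, [/\ lt x w, le w y & le w z].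

Definition components (x : X) : set (set X) :=
  [set above x `&` [set z | same_component x y z] | y in above x].

Definition terminal : set X := [set x | components x = set0].

Definition branching : set X :=
  [set x | exists C D, [/\ components x C, components x D & C <> D]].

Definition antichain (A : set X) : Prop :=
  forall x y, A x -> A y -> x <> y -> ~ le x y /\ ~ le y x.

Definition upwards_closed (A : set X) : Prop :=
  forall x y, A x -> le x y -> A y.

Definition interval_isomorphic (R : realType) (A : set X) : Prop :=
  exists (I : set R) (f : R -> X),
    [/\ is_interval I, (exists s t, [/\ I s, I t & s < t]),
        set_bij I A f &
        forall s t, I s -> I t -> (le (f s) (f t) <-> s <= t)].

Definition twig (R : realType) : set (set X) :=
  let P A := upwards_closed A /\ interval_isomorphic R A in
  [set A | P A /\ forall B, P B -> A `<=` B -> B = A].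

Definition wispy (R : realType) (K : Type) : Prop :=
  card_lt branching [set: K] /\ card_lt (twig R) [set: K].

Definition chain_condition (K : Type) : Prop :=
  forall A, antichain A -> ~ (A #= [set: K]).

End TreeOrder.

Definition embedding_on (T U : topologicalType) (A : set T) (f : T -> U) :=
  [/\ {in A &, injective f}, {within A, continuous f} &
      forall O, open O ->
        exists2 V, open V & f @` (A `&` O) = (f @` A) `&` V].

Definition noncut (X : topologicalType) : set X :=
  [set x | connected (~` [set x])].

Definition separable_below (X : topologicalType) (K : Type) : Prop :=
  exists2 D : set X, dense D & card_lt D [set: K].

Section RTree.
Context {R : realType} (X : metricType R).

Definition is_arc (x y : X) (A : set X) : Prop :=
  exists (a b : R) (f : R -> X),
    [/\ a <= b, embedding_on `[a, b]%classic f, f a = x, f b = y &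
        A = f @` `[a, b]%classic].

Definition is_isometric_arc (x y : X) (A : set X) : Prop :=
  exists (a b : R) (f : R -> X),
    [/\ a <= b,
        {in `[a, b] &, forall s t, mdist (f s) (f t) = `|s - t|},
        f a = x, f b = y & A = f @` `[a, b]%classic].

Definition Rtree : Prop :=
  forall x y : X, exists2 A, unique (is_arc x y) A & is_isometric_arc x y A.

(* [x, y]; only meaningful when the arc exists and is unique, as in an R-tree. *)
Definition tree_arc (x y : X) : set X := get (is_arc x y).

Definition cutpoint_le (p x y : X) : Prop := tree_arc p x `<=` tree_arc p y.

End RTree.

(* Main.v *)
(** Fix a root [p]. In an R-tree, [z] lies on the arc from [x] to [y] iff
[d x z + d z y = d x y], since concatenating two geodesics that meet only at
their common end point gives an arc; so the cut-point order is the betweenness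
[d p x + d x y = d p y], and any two arcs from [p] share an initial segment
ending at a median point.

(1) => (2): the components above a point are open, hence meet a dense set [D].
A branching node is determined by two points of [D] in distinct components above
it, a twig by any point of [D] in it, and terminal nodes are noncut-points.

(2) => (3): every point lies below a branching node, below a terminal node or
in a twig, and an antichain has at most one element for each of these.

(3) => (1): noncut-points other than [p] are terminal, and these form an
antichain. The spheres of rational radius around [p] are antichains with dense
union. When [K] has countable cofinality, each of them being small does not
suffice for their union to be small; a form of the Erdos-Tarski theorem on
attained cellularity closes the gap. *)
Require Import Defs.
From mathcomp Require Import all_boot all_order all_algebra.
From mathcomp Require Import all_classical all_reals all_analysis.
From mathcomp Require Import lra.

Set Implicit Arguments.
Unset Strict Implicit.
Unset Printing Implicit Defensive.

Import Order.TTheory GRing.Theory Num.Theory.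
Import numFieldNormedType.Exports.

Local Open Scope classical_set_scope.
Local Open Scope ring_scope.
Local Open Scope card_scope.

(** * Cardinal arithmetic *)

(** A total injective relation needs no default value in a possibly empty [U]; choice extracts an
    injection from it. *)
Lemma card_le_relP T U (A : set T) (B : set U) :
  A #<= B <-> exists r : T -> U -> Prop,
    (forall x, A x -> exists2 y, B y & r x y) /\
    (forall x x' y, A x -> A x' -> r x y -> r x' y -> x = x').
Proof.
split=> [|[r [rB rinj]]].
  elim/Ppointed: U => U in B *.
    rewrite emptyE => /eqP ->; exists (fun _ _ => True).
    by split=> [x []|x x' y []].
  move=> /pcard_leP[f]; exists (fun x y => y = f x); split.
    by move=> x Ax; exists (f x) => //; exact: funS.
  by move=> x x' y Ax Ax' -> /inj; apply; exact: mem_set.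
elim/Ppointed: U => U in B r rB rinj *.
  suff -> : A = set0 by exact: card_ge0.
  by rewrite -subset0 => x /rB[y]; rewrite emptyE.
have /choice[f fP] x : exists y, A x -> B y /\ r x y.
  have [Ax|nAx] := pselect (A x); last by exists point.
  by have [y By rxy] := rB x Ax; exists y.
apply/pcard_leP/injfunPex; exists f => [x Ax|x x'].
  by have [] := fP x Ax.
rewrite !inE => Ax Ax' fxx'.
have [_ rx] := fP x Ax; have [_] := fP x' Ax'; rewrite -fxx' => rx'.
exact: rinj rx rx'.
Qed.

Lemma card_leX T T' U U' (A : set T) (A' : set T') (B : set U) (B' : set U') :
  A #<= A' -> B #<= B' -> A `*` B #<= A' `*` B'.
Proof.
move=> /card_le_relP[r [rA rinj]] /card_le_relP[s [sB sinj]].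
apply/card_le_relP; exists (fun p q => r p.1 q.1 /\ s p.2 q.2); split.
  move=> [x y] [/= /rA[x' Ax' rx] /sB[y' By' sy]].
  by exists (x', y').
move=> [x y] [x' y'] [u v] /= [Ax By] [Ax' By'] [rx sy] [rx' sy'].
by rewrite (rinj _ _ _ Ax Ax' rx rx') (sinj _ _ _ By By' sy sy').
Qed.

Lemma card_le_subset_eq T U (A : set T) (B : set U) :
  A #<= B -> exists2 Z, Z `<=` B & Z #= A.
Proof.
elim/Ppointed: U => U in B *.
  rewrite emptyE => /eqP ->; exists set0; first exact: sub0set.
  by rewrite card_eq00.
move=> /pcard_leP[f]; exists (f @` A); last exact: card_image.
by move=> _ [x Ax <-]; exact: funS.
Qed.

(** Zorn on graphs of partial bijections: a maximal one exhausts [A] or [B], since otherwise a pair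
    of missed points extends it. *)
Lemma card_le_total T U (A : set T) (B : set U) : A #<= B \/ B #<= A.
Proof.
pose P (G : set (T * U)) := G `<=` A `*` B /\
  forall p q, G p -> G q -> (p.1 = q.1 <-> p.2 = q.2).
have [|G [[GAB Gfun] Gmax]] := @Zorn_bigcup _ P.
  move=> F FP Ftot; split=> [p [G FG Gp]|p q [G FG Gp] [H FH Hq]].
    exact: (FP _ FG).1.
  by have [GH|HG] := Ftot _ _ FG FH;
    [apply: (FP _ FH).2 => //; exact: GH|apply: (FP _ FG).2 => //; exact: HG].
have [domG|/existsNP[a /not_implyP[Aa Ga]]] :=
    pselect (forall a, A a -> exists b, G (a, b)).
  left; apply/card_le_relP; exists (fun a b => G (a, b)); split.
    by move=> a /domG[b Gab]; exists b => //; have [] := GAB _ Gab.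
  by move=> x x' y _ _ Gx Gx'; apply/(Gfun _ _ Gx Gx').
right; apply/card_le_relP; exists (fun b a => G (a, b)); split; last first.
  by move=> x x' y _ _ Gx Gx'; apply/(Gfun _ _ Gx Gx').
move=> b Bb; apply: contrapT => Gb.
have Gb' a' : ~ G (a', b).
  by move=> Gab; apply: Gb; exists a' => //; have [] := GAB _ Gab.
have Ga' b' : ~ G (a, b') by move=> Gab; apply: Ga; exists b'.
apply: (Gmax (G `|` [set (a, b)])).
  split; first exact: subsetUl.
  by move=> /(_ (a, b)) /(_ (or_intror erefl)) /Ga'.
split=> [p [/GAB//|->//]|[x y] [x' y'] [Gp|[-> ->]] [Gq|[-> ->]] //=].
- exact: Gfun Gp Gq.
- by split=> E; move: Gp; rewrite E; [move/Ga'|move/Gb'].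
- by split=> E; move: Gq; rewrite -E; [move/Ga'|move/Gb'].
Qed.

Lemma card_le_infinite T U (A : set T) (B : set U) :
  infinite_set A -> A #<= B -> infinite_set B.
Proof. by move=> Ainf AB /(card_le_finite AB). Qed.

Lemma card_le_finite_infinite T U (A : set T) (B : set U) :
  finite_set A -> infinite_set B -> A #<= B.
Proof.
move=> /finite_set_countable Afin /infiniteP Binf.
exact: card_le_trans Afin Binf.
Qed.

(** A point is coded by the code of an index together with its code in that piece. That [Z] absorbs
    its square is a hypothesis so that the lemma can serve in the proof of [card_leXX]. *)
Lemma card_le_bigcup_square T I V (D : set I) (F : I -> set T) (Z : set V) :
  Z `*` Z #<= Z -> D #<= Z -> (forall i, D i -> F i #<= Z) ->
  \bigcup_(i in D) F i #<= Z.
Proof.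
move=> ZZ /card_le_relP[h [hZ hinj]] FZ; apply: card_le_trans ZZ.
have /choice[r rP] i : exists r : T -> V -> Prop, D i ->
    (forall x, F i x -> exists2 y, Z y & r x y) /\
    (forall x x' y, F i x -> F i x' -> r x y -> r x' y -> x = x').
  have [Di|nDi] := pselect (D i); last by exists (fun _ _ => True).
  by have /card_le_relP[r rP] := FZ i Di; exists r.
apply/card_le_relP.
exists (fun x p => exists i, [/\ D i, F i x, h i p.1 & r i x p.2]); split.
  move=> x [i Di Fix]; have [u Zu hu] := hZ i Di.
  by have [v Zv rv] := (rP i Di).1 _ Fix; exists (u, v) => //; exists i.
move=> x x' [u v] _ _ [i [Di Fi /= hi ri]] [j [Dj Fj /= hj rj]].
move: rj Fj; rewrite -(hinj _ _ _ Di Dj hi hj) => rj Fj.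
exact: (rP i Di).2 ri rj.
Qed.

Lemma card_leU_square T V (A B : set T) (Z : set V) :
  infinite_set Z -> Z `*` Z #<= Z -> A #<= Z -> B #<= Z -> A `|` B #<= Z.
Proof.
move=> Zinf ZZ AZ BZ.
have -> : A `|` B = \bigcup_(b in [set: bool]) (if b then A else B).
  apply/seteqP; split=> [x [Ax|Bx]|x [[] _]]; [|by exists false|by left|by right].
  by exists true.
apply: card_le_bigcup_square => // [|[]//].
by apply: card_le_finite_infinite => //; exact: finite_finset.
Qed.

(** Hessenberg's theorem. Zorn yields a maximal injection of a square [Y * Y] into [Y], with [Y]
    inside [A]. If [A] did not inject into [Y], a suitable [Z] outside [Y] would allow an extension
    to the union of [Y] and [Z]. *)
Lemma card_leXX T (A : set T) : infinite_set A -> A `*` A #<= A.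
Proof.
move=> Ainf.
(* The base set is read off the diagonal of the graph, so Zorn applies to plain sets ordered by
   inclusion. *)
pose Y (G : set ((T * T) * T)) := [set x | exists z, G ((x, x), z)].
pose P G := [/\ Y G `<=` A,
  (forall x y z, G ((x, y), z) -> [/\ Y G x, Y G y & Y G z]),
  (forall x y, Y G x -> Y G y -> exists z, G ((x, y), z)) &
  (forall p q z, G (p, z) -> G (q, z) -> p = q)].
have [|G [[YA GY Gtot Ginj] Gmax]] := @Zorn_bigcup _ P.
  move=> F FP Ftot.
  have YF G x : F G -> Y G x -> Y (\bigcup_(G in F) G) x.
    by move=> FG [z Gz]; exists z, G.
  split=> [x [z [G FG Gz]]|x y z [G FG Gz]|x y [z [G FG Gz]] [t [H FH Ht]]|].
  - by have [+ _ _ _] := FP _ FG; apply; exists z.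
  - have [_ + _ _] := FP _ FG => /(_ _ _ _ Gz)[Yx Yy Yz].
    by split; apply: YF FG _.
  - wlog GH : x y z t G H FG FH Gz Ht / G `<=` H.
      move=> W; have [GH|HG] := Ftot _ _ FG FH; first exact: W Gz Ht GH.
      have [_ _ + _] := FP _ FG => /(_ x y) [||u Gu]; last by exists u, G.
      + by exists z.
      + by exists t; exact: HG.
    have [_ _ + _] := FP _ FH => /(_ x y) [||u Gu]; last by exists u, H.
    + by exists z; exact: GH.
    + by exists t.
  - move=> p q z [G FG Gp] [H FH Hq].
    have [GH|HG] := Ftot _ _ FG FH.
      by have [_ _ _] := FP _ FH; apply; [exact: GH Gp|].
    by have [_ _ _] := FP _ FG; apply; [|exact: HG Hq].
have YY : Y G `*` Y G #<= Y G.
  apply/card_le_relP; exists (fun p z => G (p, z)); split.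
    move=> [x y] [/= Yx Yy]; have [z Gz] := Gtot _ _ Yx Yy.
    by exists z => //; have [] := GY _ _ _ Gz.
  by move=> p q z _ _; exact: Ginj.
have [AY|nAY] := pselect (A #<= Y G).
  apply: card_le_trans (card_leX AY AY) _.
  exact: card_le_trans YY (subset_card_le YA).
have [Z [Zinf ZA ZZ YZ]] : exists Z : set T,
    [/\ infinite_set Z, Z `<=` A `\` Y G, Z `*` Z #<= Z & Y G #<= Z].
  (* A countably infinite [Z] does for finite [Y G]; otherwise [Z] is a copy of [Y G] inside [A]
     minus [Y G]. *)
  have [Yfin|Yinf] := pselect (finite_set (Y G)).
    have /infiniteP/card_le_subset_eq[Z ZA Zn] : infinite_set (A `\` Y G).
      move=> AYfin; apply: Ainf; rewrite -(setUIDK A (Y G)).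
      by rewrite finite_setU; split => //; exact: finite_setIr.
    have Zinf : infinite_set Z.
      by apply/infiniteP; move: Zn; rewrite card_eq_le => /andP[].
    exists Z; split => //; last exact: card_le_finite_infinite.
    apply: (@card_le_trans _ _ _ [set: nat]); last exact/infiniteP.
    by apply: countableX; rewrite (eq_countable Zn); exact: countableP.
  have [AYY|YAY] := card_le_total (A `\` Y G) (Y G).
    exfalso; apply: nAY.
    apply: card_le_trans (card_leU_square Yinf YY (card_lexx (Y G)) AYY).
    by apply: subset_card_le => x Ax; have [Yx|Yx] := pselect (Y G x); [left|right].
  have [Z ZA] := card_le_subset_eq YAY.
  rewrite card_eq_le => /andP[ZY YZ]; exists Z; split => //.
    exact: card_le_infinite YZ.
  exact: card_le_trans (card_leX ZY ZY) (card_le_trans YY YZ).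
have WZ : Y G `|` Z #<= Z by exact: card_leU_square.
have /card_le_relP[r [rZ rinj]] := card_le_trans (card_leX WZ WZ) ZZ.
(* The new pairs get values in [Z], which cannot collide with the old values in [Y G]. *)
pose N : set ((T * T) * T) := [set a | [/\ (Y G `|` Z) a.1.1, (Y G `|` Z) a.1.2,
  ~ (Y G a.1.1 /\ Y G a.1.2), Z a.2 & r a.1 a.2]].
have YGN : Y (G `|` N) = Y G `|` Z.
  apply/seteqP; split=> [x [z [Gz|[]//]]|x [[z Gz]|Zx]].
  - by left; exists z.
  - by exists z; left.
  - have [z Zz rz] : exists2 z, Z z & r (x, x) z by apply: rZ; split; right.
    by exists z; right; split => //=; [right|right|case=> Yx _; have [] := ZA _ Zx].
exfalso; apply: (Gmax (G `|` N)).
  split; first exact: subsetUl.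
  have [z Zz] := infinite_setN0 Zinf.
  have : Y (G `|` N) z by rewrite YGN; right.
  case=> t Gt /(_ _ Gt) /GY[Yz _ _].
  by have [] := ZA _ Zz.
split; rewrite ?YGN.
- by move=> x [/YA//|/ZA[]].
- move=> x y z [/GY[? ? ?]|[/= ? ? _ ? _]]; first by split; left.
  by split=> //; right.
- move=> x y Wx Wy.
  have [[Yx Yy]|nY] := pselect (Y G x /\ Y G y).
    by have [z Gz] := Gtot _ _ Yx Yy; exists z; left.
  by have [//|z Zz rz] := rZ (x, y); exists z; right.
- have GN p q z : G (p, z) -> N (q, z) -> p = q.
    case: p => x y /GY[_ _ Yz] [/= _ _ _ Zz _].
    by have [] := ZA _ Zz.
  move=> p q z [Gp|Np] [Gq|Nq].
  + exact: Ginj Gp Gq.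
  + exact: GN Gp Nq.
  + by apply/esym/(GN _ _ _ Gq Np).
  + case: Np Nq => /= [p1 p2 _ _ rp] [/= q1 q2 _ _ rq].
    exact: rinj rp rq.
Qed.

Lemma card_le_bigcup T I V (D : set I) (F : I -> set T) (Z : set V) :
  infinite_set Z -> D #<= Z -> (forall i, D i -> F i #<= Z) ->
  \bigcup_(i in D) F i #<= Z.
Proof. by move=> Zinf; apply: card_le_bigcup_square; exact: card_leXX. Qed.

Lemma card_leU T V (A B : set T) (Z : set V) :
  infinite_set Z -> A #<= Z -> B #<= Z -> A `|` B #<= Z.
Proof. by move=> Zinf; apply: card_leU_square => //; exact: card_leXX. Qed.

(** * Antichains in forest orders *)

(** An infinite [E m] cannot bound all the [E n], as it would then bound their countable union and
    hence [K]; so a strictly larger set can always be chosen next. *)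
Lemma cofinal_subsequence X K (E : nat -> set X) :
  ~ countable [set: K] -> [set: K] #<= \bigcup_n E n ->
  (forall n, ~ ([set: K] #<= E n)) ->
  exists F : nat -> set X, [/\ (forall n, exists m, F n = E m),
    (forall n, infinite_set (F n)),
    (forall m n, (m <= n)%N -> F m #<= F n),
    (forall m n, (m < n)%N -> ~ (F n #<= F m)) &
    (forall V (C : set V), (forall n, F n #<= C) -> [set: K] #<= C)].
Proof.
move=> Kunc KE nKE.
have coverE V (C : set V) : infinite_set C -> (forall n, E n #<= C) ->
    [set: K] #<= C.
  move=> Cinf EC; apply: card_le_trans KE _.
  by apply: card_le_bigcup => //; exact/infiniteP.
have upper n : exists m, forall i, (i <= n)%N -> E i #<= E m.
  elim: n => [|n [m mP]]; first by exists 0%N => i; rewrite leqn0 => /eqP ->.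
  have [le|le] := card_le_total (E m) (E n.+1).
    exists n.+1 => i; rewrite leq_eqVlt ltnS => /orP[/eqP -> //|/mP].
    by move=> /card_le_trans; apply.
  exists m => i; rewrite leq_eqVlt ltnS => /orP[/eqP -> //|]; exact: mP.
(* [p] holds the stage and the last chosen index. Dominating every [E i] up to the stage makes the
   sequence cofinal. *)
have /choice[next nextP] p : exists n, infinite_set (E p.2) ->
    [/\ infinite_set (E n), forall i, (i <= p.1)%N -> E i #<= E n,
      E p.2 #<= E n & ~ (E n #<= E p.2)].
  have [fin|inf] := pselect (finite_set (E p.2)); first by exists 0%N.
  have [m mP] := upper (maxn p.1 p.2).
  have Em := mP _ (leq_maxr _ _).
  have minf : infinite_set (E m) by exact: card_le_infinite Em.
  have [n nP] : exists n, ~ (E n #<= E m).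
    by apply/existsNP => /(coverE _ _ minf); exact: nKE.
  have [//|mn] := card_le_total (E n) (E m).
  exists n => _; split.
  - exact: card_le_infinite mn.
  - move=> i ip; apply: card_le_trans mn; apply: mP.
    exact: leq_trans ip (leq_maxl _ _).
  - exact: card_le_trans mn.
  - by move=> /card_le_trans /(_ Em).
have [n0 n0inf] : exists n, infinite_set (E n).
  apply/existsNP => Efin; apply: Kunc; apply: card_le_trans KE _.
  by apply: bigcup_countable => // n _; exact: finite_set_countable.
pose s := fix s n := if n is m.+1 then next (m, s m) else n0.
have sinf n : infinite_set (E (s n)).
  by elim: n => //= n /(nextP (n, s n))[].
have smono m n : (m <= n)%N -> E (s m) #<= E (s n).
  elim: n => [|n IH]; first by rewrite leqn0 => /eqP ->.
  rewrite leq_eqVlt ltnS => /orP[/eqP -> //|/IH /card_le_trans]; apply.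
  by have [] := nextP (n, s n) (sinf n).
exists (fun n => E (s n)); split => //.
- by move=> n; exists (s n).
- move=> m [//|n]; rewrite ltnS => mn nm.
  have [_ _ _] := nextP (n, s n) (sinf n); apply => /=.
  exact: card_le_trans nm (smono _ _ mn).
- move=> V C sC; apply: coverE => [|n].
    exact: card_le_infinite (sinf 0%N) (sC _).
  apply: card_le_trans (sC n.+1).
  by have [_ + _ _] := nextP (n, s n) (sinf n); exact.
Qed.

(** Recursion: [S n] is the finite set of points already chosen, and the infinite [H n] has a point
    outside it. *)
Lemma injective_choice X (H : nat -> set X) : (forall n, infinite_set (H n)) ->
  exists x : nat -> X, injective x /\ forall n, H n (x n).
Proof.
move=> Hinf.
have /choice[g gP] (p : nat * set X) : exists x, finite_set p.2 ->
    H p.1 x /\ ~ p.2 x.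
  have [x0 _] := infinite_setN0 (Hinf p.1).
  have [pfin|] := pselect (finite_set p.2); last by exists x0.
  have /infinite_setN0[x [Hx px]] : infinite_set (H p.1 `\` p.2).
    exact: infinite_setD.
  by exists x.
pose S := fix S n := if n is m.+1 then S m `|` [set g (m, S m)] else set0.
have Sfin n : finite_set (S n) by elim: n => [|n IH] //=; rewrite finite_setU.
have SE m n : (m < n)%N -> S n (g (m, S m)).
  elim: n => [//|n IH]; rewrite ltnS leq_eqVlt => /orP[/eqP -> /=|/IH]; first by right.
  by left.
exists (fun n => g (n, S n)); split=> [m n|n]; last first.
  by have [] := gP (n, S n) (Sfin n).
wlog mn : m n / (m < n)%N => [W|] gmn.
  by have [/W|/W/(_ (esym gmn))/esym|] := ltngtP m n; first exact.
by have [_ /=] := gP (n, S n) (Sfin n); rewrite -gmn => /(_ (SE _ _ mn)).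
Qed.

Section forest.
Context {X : Type} (le : X -> X -> Prop).
Hypothesis le_tr : forall x y z, le x y -> le y z -> le x z.
Hypothesis le_forest : forall x y z, le x z -> le y z -> le x y \/ le y x.

Lemma antichain_eq (A : set X) x y :
  antichain le A -> A x -> A y -> le x y \/ le y x -> x = y.
Proof.
move=> Aanti Ax Ay xy; apply: contrapT => /(Aanti _ _ Ax Ay)[nxy nyx].
by case: xy.
Qed.

Lemma antichainP (A : set X) :
  (forall x y, A x -> A y -> x <> y -> ~ le x y) -> antichain le A.
Proof. by move=> H x y Ax Ay xy; split; apply: H => // /esym. Qed.

(* A form of the Erdos-Tarski theorem: the supremum of the sizes of the
   antichains [E n] is attained. Passing to a subsequence, the cardinals of the
   [F n] increase strictly to that of [K]. Write [U n x] for the elements of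
   [F n] above [x]. If some [F m] has, for every [k], infinitely many [x] with
   some [U n x] as large as [F k], gluing such sets [U n x] above distinct [x]
   works. Otherwise, removing finitely many points of each [F m], the elements
   of [F n] above points of [F m] are fewer than [F n] for all large [n];
   discarding them leaves antichains whose union is an antichain. *)
Lemma antichain_of_countable_cover K (E : nat -> set X) :
  (forall n, antichain le (E n)) ->
  ~ countable [set: K] -> [set: K] #<= \bigcup_n E n ->
  exists2 C, antichain le C & [set: K] #<= C.
Proof.
move=> Eanti Kunc KE.
have [[n KEn]|nKE] := pselect (exists n, [set: K] #<= E n); first by exists (E n).
have {nKE}nKE n : ~ ([set: K] #<= E n) by move=> KEn; apply: nKE; exists n.
have [F [FE Finf Fle Flt FK]] := cofinal_subsequence Kunc KE nKE.
have Fanti n : antichain le (F n) by have [m ->] := FE n.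
pose U n x := F n `&` [set y | le x y].
pose H m k := [set x | F m x /\ exists n, F k #<= U n x].
have [[m Hinf]|Hfin] := pselect (exists m, forall k, infinite_set (H m k)).
  have [x [xinj xH]] := injective_choice Hinf.
  have /choice[n nP] k := (xH k).2.
  exists (\bigcup_k U (n k) (x k)); last first.
    apply: FK => k; apply: card_le_trans (nP k) _.
    by apply: subset_card_le => y Uy; exists k.
  apply: antichainP => y z [i _ [Fy xy]] [j _ [Fz xz]] yz leyz.
  (* Both points lie below [z], hence are comparable, and both belong to the antichain [F m]. *)
  have xij : x i = x j.
    apply: (antichain_eq (Fanti m)); [exact: (xH i).1|exact: (xH j).1|].
    exact: le_forest (le_tr xy leyz) xz.
  move: Fz; rewrite -(xinj _ _ xij) => Fz.
  by apply: yz; apply: (antichain_eq (Fanti (n i))) => //; left.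
have /choice[k kP] m : exists k, finite_set (H m k).
  apply: contrapT => nfin; apply: Hfin; exists m => k fin.
  by apply: nfin; exists k.
pose Q m := F m `\` H m (k m).
(* Each index exceeds all earlier ones and their thresholds [k]; starting at 1 gives every [s j] a
   predecessor. *)
pose s := fix s n := if n is m.+1 then (maxn (s m) (k (s m))).+1 else 1%N.
have slt i j : (i < j)%N -> (s i < s j)%N /\ (k (s i) < s j)%N.
  elim: j => [//|j IH]; rewrite ltnS leq_eqVlt => /orP[/eqP ->|/IH[]].
    by rewrite /= !ltnS leq_maxl leq_maxr.
  by move=> a b; split; apply: ltn_trans (_ : s j < s j.+1)%N => //=;
    rewrite ltnS leq_maxl.
have s_gt0 j : (0 < s j)%N by case: j.
have s_ge j : (j <= s j)%N.
  by elim: j => // j IH /=; rewrite ltnS (leq_trans IH) // leq_maxl.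
(* A point of [F (s i)] has at most one element of [F (s j)] below it, but may have many above it;
   hence only [over] is restricted to [Q]. *)
pose below i j := [set y | F (s j) y /\ exists2 x, F (s i) x & le y x].
pose over i j := [set y | F (s j) y /\ exists2 x, Q (s i) x & le x y].
pose G j := [set y | Q (s j) y /\
  forall i, (i < j)%N -> ~ below i j y /\ ~ over i j y].
exists (\bigcup_j G j).
  apply: antichainP => y z [i _ [Qy Gy]] [j _ [Qz Gz]] yz leyz.
  have [ij|ji|ij] := ltngtP i j.
  - by have [_] := Gz _ ij; apply; split; [exact: Qz.1|exists y].
  - by have [+ _] := Gy _ ji; apply; split; [exact: Qy.1|exists z => //; exact: Qz.1].
  - apply: yz; apply: (antichain_eq (Fanti (s i))); [exact: Qy.1| |by left].
    by rewrite ij; exact: Qz.1.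
apply: FK => j0; apply: card_le_trans (Fle _ _ (s_ge j0)) _.
apply: (@card_le_trans _ _ _ (G j0)); last first.
  by apply: subset_card_le => y Gy; exists j0.
move: j0 => j.
(* [F N] is strictly smaller than [F (s j)] and still bounds everything discarded from it. *)
pose N := (s j).-1.
have sN : (N < s j)%N by rewrite ltn_predL.
have leN i : (i < s j)%N -> F i #<= F N.
  by move=> ij; apply: Fle; rewrite -ltnS prednK.
have belowN i : (i < j)%N -> below i j #<= F N.
  move=> /slt[+ _] => /leN; apply: card_le_trans.
  apply/card_le_relP; exists (fun y x => F (s i) x /\ le y x); split.
    by move=> y [_ [x Fx yx]]; exists x.
  move=> y y' x [Fy _] [Fy' _] [_ yx] [_ y'x].
  by apply: (antichain_eq (Fanti (s j))) => //; exact: le_forest yx y'x.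
have overN i : (i < j)%N -> over i j #<= F N.
  move=> /slt[/leN sN' /leN kN].
  apply: (@card_le_trans _ _ _ (\bigcup_(x in Q (s i)) U (s j) x)).
    by apply: subset_card_le => y [Fy [x Qx xy]]; exists x.
  apply: card_le_bigcup => //.
    exact: card_le_trans (card_le_setD _ _) sN'.
  move=> x [Fx Hx]; apply: card_le_trans kN.
  have [//|FU] := card_le_total (U (s j) x) (F (k (s i))).
  by exfalso; apply: Hx; split => //; exists (s j).
pose B := H (s j) (k (s j)) `|` \bigcup_(i in `I_j) (below i j `|` over i j).
have BN : B #<= F N.
  apply: card_leU => //; first exact: card_le_finite_infinite.
  apply: card_le_bigcup => // [|i ij].
    exact: card_le_finite_infinite.
  by apply: card_leU => //; [exact: belowN|exact: overN].
have FGB : F (s j) `<=` G j `|` B.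
  move=> y Fy; have [By|nBy] := pselect (B y); first by right.
  left; split; first by split => // Hy; apply: nBy; left.
  by move=> i ij; split=> ?; apply: nBy; right; exists i => //; [left|right].
(* If [G j] were no larger than [F N], so would be all of [F (s j)]; hence [G j] is large enough to
   absorb [B]. *)
have [GN|NG] := card_le_total (G j) (F N).
  exfalso; apply: (Flt _ _ sN); apply: card_le_trans (subset_card_le FGB) _.
  exact: card_leU.
apply: card_le_trans (subset_card_le FGB) _; apply: card_leU => //.
  exact: card_le_infinite NG.
exact: card_le_trans BN NG.
Qed.

End forest.

(** * Betweenness in R-trees *)

(** The image of the compact set [A] minus [O] is compact, hence closed; its complement is the
    required open set. *)
Lemma compact_embedding (T U : topologicalType) (A : set T) (f : T -> U) :
  hausdorff_space U -> compact A -> {in A &, injective f} ->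
  {within A, continuous f} -> embedding_on A f.
Proof.
move=> hU cA finj fcont; split=> // O oO.
exists (~` (f @` (A `&` ~` O))).
  apply: closed_openC; apply: compact_closed => //.
  apply: continuous_compact; first by apply: continuous_subspaceW fcont; exact: subIsetl.
  by apply: compact_closedI => //; exact: open_closedC.
apply/seteqP; split=> [_ [x [Ax Ox] <-]|_ [[x Ax <-] nO]].
  split; first by exists x.
  by move=> [y [Ay nOy]] /finj yx; apply: nOy; rewrite yx // inE.
by exists x => //; split => //; apply: contrapT => nOx; apply: nO; exists x.
Qed.

Lemma lipschitz_within (R : realType) (X : metricType R) (A : set R) (f : R -> X) :
  {in A &, forall s t, mdist (f s) (f t) <= `|s - t|} ->
  {within A, continuous f}.
Proof.
move=> flip; apply/subspace_continuousP => s As.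
apply/metricType_numDomainType.cvgrPdist_lt => e e0.
rewrite /prop_near1 /nbhs /= /within /=.
apply/nbhs_ballP; exists e => //= t; rewrite /ball /= => st At.
by apply: le_lt_trans st; apply: flip; rewrite inE.
Qed.

Lemma segmentE (R : realType) (a b s : R) :
  `[a, b]%classic s = (a <= s <= b) :> Prop.
Proof. by rewrite -[LHS]/(is_true (s \in `[a, b])) in_itv. Qed.

Section metric.
Context {R : realType} {X : metricType R}.

Definition between (x z y : X) := mdist x z + mdist z y = mdist x y.

Lemma between_sym x z y : between x z y -> between y z x.
Proof.
by rewrite /between (metric_sym y z) (metric_sym z x) (metric_sym y x) addrC.
Qed.

Lemma between_trans p x y z : between p x y -> between p y z -> between p x z.
Proof.
rewrite /between => pxy pyz.
have := metric_triangle x y z; have := metric_triangle p x z; lra.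
Qed.

Lemma between_transr p x y z : between p x y -> between p y z -> between x y z.
Proof.
rewrite /between => pxy pyz.
have := metric_triangle x y z; have := metric_triangle p x z; lra.
Qed.

Lemma between_antisym p x y : between p x y -> between p y x -> x = y.
Proof.
rewrite /between (metric_sym y x) => pxy pyx; apply: mdist_positivity; lra.
Qed.

End metric.

Section Rtree.
Context {R : realType} {X : metricType R}.
Hypothesis X_tree : Rtree X.

Lemma tree_arc_unique (x y : X) A : is_arc x y A -> A = tree_arc x y.
Proof.
have [B [arcB uniqB] _] := X_tree x y.
move=> arcA; rewrite -(uniqB _ arcA); apply: uniqB.
by apply: getPex; exists A.
Qed.

Lemma geodesic (x y : X) : exists f : R -> X,
  [/\ f 0 = x, f (mdist x y) = y,
    (forall s t : R, 0 <= s <= mdist x y -> 0 <= t <= mdist x y ->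
      mdist (f s) (f t) = `|s - t|) &
    tree_arc x y = f @` `[0, mdist x y]%classic].
Proof.
have [A [arcA _] [a [b [f [ab fiso fa fb AE]]]]] := X_tree x y.
have dE : mdist x y = b - a.
  rewrite -fa -fb fiso ?in_itv /= ?lexx ?ab // distrC ger0_norm //.
  by rewrite subr_ge0.
exists (fun s => f (a + s)); split; rewrite ?addr0 // ?dE.
- by rewrite addrC subrK.
- move=> s t /andP[s0 sb] /andP[t0 tb].
  rewrite fiso ?in_itv /=; last 2 first.
  + by apply/andP; split; lra.
  + by apply/andP; split; lra.
  by congr (Num.norm _); lra.
rewrite -(tree_arc_unique arcA) AE; apply/seteqP; split=> _ [s + <-].
  rewrite segmentE => /andP[sa sb].
  exists (s - a); last by rewrite addrC subrK.
  by rewrite segmentE; apply/andP; split; lra.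
rewrite segmentE => /andP[sa sb].
by exists (a + s) => //; rewrite segmentE; apply/andP; split; lra.
Qed.

Lemma tree_arc_between (x y z : X) : tree_arc x y z -> between x z y.
Proof.
have [f [f0 fd fiso ->]] := geodesic x y.
move=> [s]; rewrite segmentE => /andP[s0 sd] <-; rewrite /between.
have xs : mdist x (f s) = s.
  by rewrite -{1}f0 fiso ?lexx ?s0 ?mdist_ge0 // distrC subr0 ger0_norm.
have sy : mdist (f s) y = mdist x y - s.
  by rewrite -{1}fd fiso ?lexx ?s0 ?mdist_ge0 // distrC ger0_norm ?subr_ge0.
by rewrite xs sy addrC subrK.
Qed.

(** The glued path [g] is 1-Lipschitz by the triangle inequality and injective since the geodesics
    meet only at [z]. Being an embedding of a compact interval, it is the arc from [x] to [y], and
    it passes through [z]. *)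
Lemma tree_arc_concat (x z y : X) :
  (forall u, tree_arc x z u -> tree_arc z y u -> u = z) -> tree_arc x y z.
Proof.
move=> meet.
have [f [f0 fd fiso fE]] := geodesic x z.
have [h [h0 hd hiso hE]] := geodesic z y.
set a := mdist x z in fd fiso fE; set b := mdist z y in hd hiso hE.
have a0 : 0 <= a by exact: mdist_ge0.
have b0 : 0 <= b by exact: mdist_ge0.
pose g (s : R) := if s <= a then f s else h (s - a).
have lip_cross (s t : R) : 0 <= s <= a -> a <= t <= a + b ->
    mdist (f s) (h (t - a)) <= t - s.
  move=> /andP[s0 sa] /andP[ta tb].
  apply: (le_trans (metric_triangle _ z _)).
  have -> : mdist (f s) z = a - s.
    rewrite -fd fiso ?lexx ?s0 ?sa ?a0 // distrC ger0_norm //; lra.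
  have -> : mdist z (h (t - a)) = t - a.
    rewrite -h0 hiso ?lexx ?b0 //; last by apply/andP; split; lra.
    rewrite distrC subr0 ger0_norm //; lra.
  lra.
have lip_lt (s t : R) : 0 <= s -> s <= t -> t <= a + b ->
    mdist (g s) (g t) <= t - s.
  move=> s0 st tb; rewrite /g.
  have [sa|sa] := leP s a; have [ta|ta] := leP t a.
  - rewrite fiso; [|by apply/andP; split; lra..].
    by rewrite distrC ger0_norm //; lra.
  - by apply: lip_cross; apply/andP; split; lra.
  - lra.
  - rewrite hiso; [|by apply/andP; split; lra..].
    by rewrite distrC ger0_norm //; lra.
have inj_lt (s t : R) : 0 <= s -> s < t -> t <= a + b -> g s <> g t.
  move=> s0 st tb; rewrite /g.
  have [sa|sa] := leP s a; have [ta|ta] := leP t a.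
  - move=> E; have := fiso s t.
    rewrite E mdistxx distrC ger0_norm; last lra.
    by move=> H; have : 0 = t - s by [apply: H; apply/andP; split; lra]; lra.
  - move=> E; have fsz : f s = z.
      apply: meet; first by rewrite fE; exists s => //; rewrite segmentE s0.
      rewrite hE; exists (t - a) => //.
      by rewrite segmentE; apply/andP; split; lra.
    have := hiso 0 (t - a); rewrite h0 -E fsz mdistxx distrC subr0 ger0_norm; last lra.
    by move=> H; have : 0 = t - a by [apply: H; apply/andP; split; lra]; lra.
  - by have := lt_le_trans (lt_trans sa st) ta; rewrite ltxx.
  - move=> E; have := hiso (s - a) (t - a).
    rewrite E mdistxx distrC ger0_norm; last lra.
    by move=> H; have : 0 = t - a - (s - a) by [apply: H; apply/andP; split; lra]; lra.
have /tree_arc_unique <- : is_arc x y (g @` `[0, a + b]%classic).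
  exists 0, (a + b), g; split => //.
  - lra.
  - apply: compact_embedding.
    + exact: metric_hausdorff.
    + exact: segment_compact.
    + move=> s t; rewrite !inE !segmentE => /andP[s0 sb] /andP[t0 tb] gst.
      have [st|ts|//] := ltgtP s t; first by case: (inj_lt _ _ s0 st tb).
      by case: (inj_lt _ _ t0 ts sb).
    + apply: lipschitz_within => s t.
      rewrite !inE !segmentE => /andP[s0 sb] /andP[t0 tb].
      have [st|ts] := leP s t.
        by rewrite distrC ger0_norm ?subr_ge0 //; exact: lip_lt.
      have {}ts := ltW ts.
      by rewrite metric_sym ger0_norm ?subr_ge0 //; exact: lip_lt.
  - by rewrite /g a0.
  - rewrite /g; have [|_] := leP (a + b) a; last by rewrite addrC addKr.
    (* The degenerate case [z = y]. *)
    move=> abz; have b00 : b = 0 by lra.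
    rewrite b00 addr0 fd -hd b00 h0 //.
exists a; last by rewrite /g lexx.
by rewrite segmentE a0; lra.
Qed.

Lemma tree_arcP (x y z : X) : tree_arc x y z <-> between x z y.
Proof.
split=> [/tree_arc_between //|xzy]; apply: tree_arc_concat => u.
move=> /tree_arc_between + /tree_arc_between; rewrite /between in xzy *.
rewrite (metric_sym z u) => xuz zuy; apply: mdist_positivity.
have := metric_triangle x u y; have := mdist_ge0 u z; lra.
Qed.

Lemma cutpoint_leP (p x y : X) : cutpoint_le p x y <-> between p x y.
Proof.
split=> [|pxy u /tree_arcP pux].
  by move=> /(_ x) pxy; apply/tree_arcP/pxy/tree_arcP; rewrite /between mdistxx addr0.
by apply/tree_arcP; exact: between_trans pux pxy.
Qed.

Lemma between_point (p y : X) (r : R) : 0 <= r <= mdist p y ->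
  exists2 x, between p x y & mdist p x = r.
Proof.
move=> rd; have [f [f0 fd fiso fE]] := geodesic p y.
exists (f r); first by apply/tree_arcP; rewrite fE; exists r; rewrite ?segmentE.
rewrite -{1}f0 fiso ?lexx ?mdist_ge0 // distrC subr0 ger0_norm //.
by case/andP: rd.
Qed.

Lemma between_dist (p y u v : X) : between p u y -> between p v y ->
  mdist u v = `|mdist p u - mdist p v|.
Proof.
have [f [f0 fd fiso fE]] := geodesic p y.
move=> /tree_arcP + /tree_arcP; rewrite fE.
move=> [s]; rewrite segmentE => sd <- [t]; rewrite segmentE => td <-.
have d0 (r : R) : 0 <= r <= mdist p y -> mdist p (f r) = r.
  move=> rd; rewrite -{1}f0 fiso ?lexx ?mdist_ge0 // distrC subr0 ger0_norm //.
  by case/andP: rd.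
by rewrite fiso // !d0.
Qed.

Lemma between_le (p y u v : X) : between p u y -> between p v y ->
  mdist p u <= mdist p v -> between p u v.
Proof.
move=> pu pv uv; rewrite /between (between_dist pu pv) distrC ger0_norm; lra.
Qed.

(* [w] is the last point of the arc from [p] to [y] lying on the arc from [p]
   to [z]; the arcs from [w] to [y] and to [z] then meet only at [w]. *)
Lemma median (p y z : X) :
  exists w, [/\ between p w y, between p w z & between y w z].
Proof.
pose S := [set t | exists2 u, between p u y /\ between p u z & mdist p u = t].
have S0 : S !=set0.
  exists 0, p; last exact: mdistxx.
  by rewrite /between mdistxx !add0r.
have Sub : ubound S (mdist p y).
  by move=> _ [u [puy _] <-]; have := mdist_ge0 u y; rewrite /between in puy; lra.
have hS : has_sup S by split => //; exists (mdist p y).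
set m := sup S.
have my : m <= mdist p y by exact: ge_sup.
have m0 : 0 <= m.
  have [t St] := S0; apply: (@le_trans _ _ t).
    by case: St => u _ <-; exact: mdist_ge0.
  exact: sup_upper_bound.
have [w pwy pwm] := between_point (introT andP (conj m0 my)).
have pwz : between p w z.
  apply/eqP; rewrite eq_le metric_triangle andbT.
  (* The supremum is attained: a common point [u] within [e / 2] of [w] shows that the detour
     through [w] costs at most [e]. *)
  apply/ler_addgt0Pl => e e0.
  have e20 : 0 < e / 2 by rewrite divr_gt0.
  have [t [u [puy puz] put] mt] := sup_adherent e20 hS.
  have um : mdist p u <= m by apply: sup_upper_bound => //; exists u.
  have := between_dist pwy puy; rewrite pwm ger0_norm; last lra.
  have := metric_triangle w u z.
  move: mt; rewrite -/m; rewrite /between in puz; lra.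
exists w; split => //; apply/tree_arcP/tree_arc_concat => u.
move=> /tree_arcP /between_sym wuy /tree_arcP wuz.
have puy : between p u y.
  apply: between_sym; apply: between_trans (between_sym pwy).
  exact: between_sym.
have puz : between p u z.
  apply: between_sym; apply: between_trans (between_sym pwz).
  exact: between_sym.
have um : mdist p u <= m by apply: sup_upper_bound => //; exists u.
(* [u] lies beyond [w] as seen from [p], yet its distance from [p] is at most [m]. *)
have := between_transr (between_sym wuy) (between_sym pwy).
rewrite /between (metric_sym u w) (metric_sym w p) (metric_sym u p) => E.
by apply: mdist_positivity; have := mdist_ge0 u w; rewrite (metric_sym u w); lra.
Qed.

(** The arc from [y] to [z] descends to the median [w] first, and [x] lies between [w] and [y]:
    closer to [p] than [w], it would lie below [z]. *)
Lemma between_leave (p y z x : X) : between p x y -> ~ between p x z ->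
  between y x z.
Proof.
move=> pxy npxz; have [w [pwy pwz ywz]] := median p y z.
have [xw|/ltW wx] := leP (mdist p x) (mdist p w).
  by exfalso; apply: npxz; apply: between_trans pwz; exact: between_le pwy xw.
apply: between_trans ywz; apply: between_sym.
exact: between_transr (between_le pwy pxy wx) pxy.
Qed.


(** * The cut-point order *)

Lemma geodesic_connected (x y : X) : connected (tree_arc x y).
Proof.
have [f [_ _ fiso ->]] := geodesic x y.
apply: connected_continuous_connected; first exact: segment_connected.
apply: lipschitz_within => s t; rewrite !inE !segmentE => sd td.
by rewrite fiso.
Qed.

Section root.
Variable p : X.

Local Notation le := (cutpoint_le p).

Lemma cutpoint_refl x : le x x.
Proof. by []. Qed.

Lemma cutpoint_trans x y z : le x y -> le y z -> le x z.
Proof. exact: subset_trans. Qed.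

Lemma cutpoint_antisym x y : le x y -> le y x -> x = y.
Proof. by move=> /cutpoint_leP xy /cutpoint_leP; exact: between_antisym. Qed.

Lemma cutpoint_root x : le p x.
Proof. by apply/cutpoint_leP; rewrite /between mdistxx add0r. Qed.

Lemma cutpoint_mdist x y : le x y -> mdist x y = mdist p y - mdist p x.
Proof. by move=> /cutpoint_leP; rewrite /between; lra. Qed.

Lemma cutpoint_mdist_le x y : le x y -> mdist p x <= mdist p y.
Proof. by move=> /cutpoint_mdist; have := mdist_ge0 x y; lra. Qed.

Lemma cutpoint_le_mdist x y z : le x z -> le y z ->
  mdist p x <= mdist p y -> le x y.
Proof.
move=> /cutpoint_leP xz /cutpoint_leP yz xy; apply/cutpoint_leP.
exact: between_le xz yz xy.
Qed.

Lemma cutpoint_forest x y z : le x z -> le y z -> le x y \/ le y x.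
Proof.
move=> xz yz; have [xy|/ltW yx] := leP (mdist p x) (mdist p y).
  by left; exact: cutpoint_le_mdist xz yz xy.
by right; exact: cutpoint_le_mdist yz xz yx.
Qed.

Lemma cutpoint_point y (r : R) : 0 <= r <= mdist p y ->
  exists2 x, le x y & mdist p x = r.
Proof.
move=> /between_point[x xy xr]; exists x => //.
exact/cutpoint_leP.
Qed.

Lemma cutpoint_leave x y z : le x y -> ~ le x z ->
  mdist x y + mdist x z = mdist y z.
Proof.
move=> /cutpoint_leP xy nxz; rewrite (metric_sym x y).
by apply: between_leave xy _ => /cutpoint_leP.
Qed.

(** The median is the meet: a common lower bound strictly above it would give a shortcut from [y] to
    [z]. *)
Lemma cutpoint_meet y z : exists w, [/\ le w y, le w z &
  forall u, le u y -> le u z -> le u w].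
Proof.
have [w [wy wz ywz]] := median p y z.
have [wy' wz'] : le w y /\ le w z by split; apply/cutpoint_leP.
exists w; split => // u uy uz.
have [//|wu] := cutpoint_forest uy wy'.
suff -> : u = w by [].
apply: mdist_positivity; have := metric_triangle y u z; have := mdist_ge0 u w.
move: ywz; rewrite /between (metric_sym y w) (metric_sym y u) (metric_sym u w).
rewrite (cutpoint_mdist wy') (cutpoint_mdist wz') (cutpoint_mdist uy).
rewrite (cutpoint_mdist uz) (cutpoint_mdist wu); lra.
Qed.

(** Leaving the points above [x] from [y] means passing through [x], at distance [mdist x y]. *)
Lemma open_above x : open (above le x).
Proof.
rewrite openE => y [xy nxy]; apply/nbhs_ballP; exists (mdist x y).
  by rewrite /= mdist_gt0; exact/eqP.
move=> z; rewrite ballEmdist /= => yz; split.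
  apply: contrapT => /(cutpoint_leave xy).
  by have := mdist_ge0 x z; lra.
by move=> xz; move: yz; rewrite xz metric_sym ltxx.
Qed.

Lemma closed_up x : closed [set y | le x y].
Proof.
rewrite -[X in closed X]setCK; apply: open_closedC.
rewrite openE => y /= nxy; apply/nbhs_ballP; exists (mdist x y).
  rewrite /= mdist_gt0; apply/eqP => xy; apply: nxy; rewrite xy.
  exact: cutpoint_refl.
move=> z; rewrite ballEmdist /= => yz xz.
have := cutpoint_leave xz nxy; have := mdist_ge0 x z.
by rewrite (metric_sym z y); lra.
Qed.

Lemma terminalP x : terminal le x <-> forall y, le x y -> x = y.
Proof.
split=> [xterm y xy|xmax].
  apply: contrapT => nxy.
  have : components le x (above le x `&` [set z | same_component le x y z]).
    by exists y.
  by rewrite [components le x]xterm.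
rewrite /terminal /= -subset0 => C [y [xy nxy] _].
exact/nxy/xmax.
Qed.

Lemma same_component_refl x y : above le x y -> same_component le x y y.
Proof. by move=> xy; exists y; split => //; exact: cutpoint_refl. Qed.

Lemma same_component_sym x y z :
  same_component le x y z -> same_component le x z y.
Proof. by move=> [w [xw wy wz]]; exists w. Qed.

Lemma same_component_trans x y z u : same_component le x y z ->
  same_component le x z u -> same_component le x y u.
Proof.
move=> [w [xw wy wz]] [v [xv vz vu]].
have [wv|vw] := cutpoint_forest wz vz.
  by exists w; split => //; exact: cutpoint_trans wv vu.
by exists v; split => //; exact: cutpoint_trans vw wy.
Qed.

Lemma branchingP x : branching le x <-> exists y z,
  [/\ above le x y, above le x z & ~ same_component le x y z].
Proof.
split=> [[_ [_ [[y xy <-] [z xz <-] CD]]]|[y [z [xy xz nyz]]]].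
  exists y, z; split => // yz; apply: CD; congr (_ `&` _).
  apply/seteqP; split=> u /=; last exact: same_component_trans.
  exact/same_component_trans/same_component_sym.
exists (above le x `&` [set u | same_component le x y u]),
  (above le x `&` [set u | same_component le x z u]).
split; [by exists y|by exists z|].
move=> /seteqP[+ _] => /(_ y)[|_ /same_component_sym //].
by split => //; exact: same_component_refl.
Qed.

Lemma ball_same_component x y z : above le x y -> mdist y z < mdist x y ->
  same_component le x y z.
Proof.
move=> [xy nxy] yz; have dxy := cutpoint_mdist xy.
(* The point [w] at distance [e] below [y] is still strictly above [x], but too far from [y] for the
   arc from [y] to [z] to pass through it. *)
pose e := (mdist x y + mdist y z) / 2.
have ey : mdist y z < e by rewrite /e; lra.
have ex : e < mdist x y by rewrite /e; lra.
have [|w wy pw] := @cutpoint_point y (mdist p y - e).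
  have := mdist_ge0 y z; have := mdist_ge0 p x; move=> px0 yz0.
  by apply/andP; split; lra.
have xw : le x w by apply: cutpoint_le_mdist xy wy _; rewrite pw; lra.
exists w; split => //.
  by split => // xw'; move: pw; rewrite -xw'; lra.
apply: contrapT => /(cutpoint_leave wy); rewrite (cutpoint_mdist wy).
by have := mdist_ge0 w z; lra.
Qed.

Lemma dense_above (D : set X) x y : dense D -> above le x y ->
  exists2 d, D d & same_component le x y d /\ above le x d.
Proof.
move=> densD xy.
have xy0 : 0 < mdist x y by rewrite mdist_gt0; exact/eqP/(proj2 xy).
have [||d [[yd xd] Dd]] := densD ((ball y (mdist x y)) ° `&` above le x).
- exists y; split => //; exact: (nbhsx_ballx y _ xy0).
- by apply: openI; [exact: open_interior|exact: open_above].
exists d => //; split => //; apply: ball_same_component => //.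
by move/interior_subset: yd; rewrite ballEmdist.
Qed.

(** If [b] and [c] both separate [d] from [e], they are comparable, being below [d]; were they
    distinct, the upper one would put [d] and [e] in one component above the lower. *)
Lemma branching_card_le (D : set X) : dense D -> branching le #<= D `*` D.
Proof.
move=> densD; apply/card_le_relP.
exists (fun b q => [/\ above le b q.1, above le b q.2 &
  ~ same_component le b q.1 q.2]); split.
  move=> b /branchingP[y [z [by_ bz nyz]]].
  have [d Dd [yd bd]] := dense_above densD by_.
  have [e De [ze be]] := dense_above densD bz.
  exists (d, e) => //; split => //= de; apply: nyz.
  apply: same_component_trans yd _; apply: same_component_trans de _.
  exact: same_component_sym.
move=> b c [d e] _ _ /= [bd be nbde] [cd ce ncde].
have lt_same u v : above le v d -> above le v e -> le u v -> u <> v ->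
  same_component le u d e.
  by move=> vd ve uv nuv; exists v; split; [|exact: (proj1 vd)|exact: (proj1 ve)].
apply: contrapT => nbc.
have [bc|cb] := cutpoint_forest (proj1 bd) (proj1 cd).
  exact/nbde/(lt_same _ c).
by apply/ncde/(lt_same _ b) => // /esym.
Qed.

Lemma interval_isomorphic_total A x y : interval_isomorphic le R A ->
  A x -> A y -> le x y \/ le y x.
Proof.
move=> [I [f [_ _ [_ _ fsurj] fle]]] /fsurj[s Is <-] /fsurj[t It <-].
have [st|/ltW ts] := leP s t; first by left; apply/fle.
by right; apply/fle.
Qed.

Lemma twig_total A x y : twig le R A -> A x -> A y -> le x y \/ le y x.
Proof. by move=> [[_ isoA] _]; exact: interval_isomorphic_total. Qed.

(** Elements of either twig below [x] are comparable, so one twig contains the other; maximality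
    gives equality. *)
Lemma twig_disjoint A B x : twig le R A -> twig le R B -> A x -> B x -> A = B.
Proof.
move=> tA tB Ax Bx.
have [[upA isoA] maxA] := tA; have [[upB isoB] maxB] := tB.
have [AB|/existsNP[a /not_implyP[Aa nBa]]] := pselect (A `<=` B).
  by apply/esym/maxA.
apply: maxB => // b Bb.
have ax : le a x.
  by have [//|xa] := twig_total tA Aa Ax; case: nBa; exact: upB xa.
have [bx|xb] := twig_total tB Bb Bx; last exact: upA Ax xb.
have [ab|ba] := cutpoint_forest ax bx; first exact: upA Aa ab.
by case: nBa; exact: upB ba.
Qed.

Lemma twig_card_le (D : set X) : dense D -> twig le R #<= D.
Proof.
move=> densD; apply/card_le_relP; exists (fun A d => A d); split; last first.
  by move=> A B d tA tB; exact: twig_disjoint.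
move=> A [[upA [I [f [_ [s [t [Is It st]]] [fA finj _] fle]]]] _].
have fst : above le (f s) (f t).
  split; first by apply/fle => //; exact: ltW.
  by move=> /finj; rewrite !inE => /(_ Is It) E; move: st; rewrite E ltxx.
have [d Dd [_ [fsd _]]] := dense_above densD fst.
by exists d => //; exact: upA (fA _ Is) fsd.
Qed.

(** The complement of a terminal node other than the root is a union of arcs from the root, none of
    which passes through the node. *)
Lemma terminal_noncut : terminal le `<=` @noncut X.
Proof.
move=> x /terminalP xmax; rewrite /noncut /=.
have [xp|xp] := pselect (x = p).
  suff -> : ~` [set x] = set0 by exact: connected0.
  rewrite -subset0 => y /=; apply; apply/esym/xmax; rewrite xp.
  exact: cutpoint_root.
have -> : ~` [set x] = \bigcup_(y in ~` [set x]) tree_arc p y.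
  apply/seteqP; split=> [y yx|z [y yx pzy] zx].
    by exists y => //; apply/tree_arcP; rewrite /between mdistxx addr0.
  apply: yx; apply/esym/xmax; rewrite -zx.
  exact/cutpoint_leP/tree_arcP.
apply: bigcup_connected => [|y _]; last exact: geodesic_connected.
by exists p => y _; apply/tree_arcP; rewrite /between mdistxx add0r.
Qed.

(** For nonterminal [x] other than [p], the points above [x] form a nonempty clopen part of the
    complement of [x] that misses [p]. *)
Lemma noncut_terminal : @noncut X `<=` terminal le `|` [set p].
Proof.
move=> x xnoncut; have [|xp] := pselect (x = p); first by right.
left; apply/terminalP => y xy; apply: contrapT => nxy.
have aboveE : above le x = ~` [set x].
  apply: xnoncut; first by exists y.
  - exists (above le x); first exact: open_above.
    by apply/esym/setIidPr => z [_ xz] /= zx; apply: xz.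
  - exists [set z | le x z]; first exact: closed_up.
    apply/seteqP; split=> z [xz zx]; split => //; first by move/esym.
    by move=> xz'; apply: xz.
have : above le x p by rewrite aboveE /= => px; apply: xp.
by move=> [/cutpoint_antisym /(_ (cutpoint_root x))].
Qed.

Lemma up_chain_twig a : (exists b, above le a b) ->
  (forall y z, le a y -> le a z -> le y z \/ le z y) ->
  exists2 A, twig le R A & A a.
Proof.
move=> [b [ab nab]] achain.
(* Any upwards-closed chain through [a] lies in [M], which gives maximality; distance from the root
   identifies [M] with an interval. *)
pose M := [set y | (forall u v, le y u -> le y v -> le u v \/ le v u) /\
  (le a y \/ le y a)].
have Ma : M a by split => //; left; exact: cutpoint_refl.
have upM : upwards_closed le M.
  move=> y z [ychain ya] yz; split.
    by move=> u v zu zv; apply: ychain; exact: cutpoint_trans yz _.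
  case: ya => [ay|ya]; first by left; exact: cutpoint_trans ay yz.
  exact: ychain.
have totM y z : M y -> M z -> le y z \/ le z y.
  move=> [ychain [ay|ya]] [zchain [az|za]].
  - exact: achain.
  - by right; exact: cutpoint_trans za ay.
  - by left; exact: cutpoint_trans ya az.
  - exact: cutpoint_forest ya za.
have leM y z : M y -> M z -> mdist p y <= mdist p z -> le y z.
  move=> My Mz yz; have [//|zy] := totM _ _ My Mz.
  exact: cutpoint_le_mdist (@cutpoint_refl y) zy yz.
exists M => //; split; last first.
  move=> B [upB isoB] MB.
  have totB y z : B y -> B z -> le y z \/ le z y.
    exact: interval_isomorphic_total.
  apply/seteqP; split => // y By; split; last by apply: totB => //; exact: MB.
  by move=> u v yu yv; apply: totB; [exact: upB yu|exact: upB yv].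
split => //.
pose I := [set mdist p y | y in M].
pose f t := xget p (M `&` [set y | mdist p y = t]).
have fP t : I t -> M (f t) /\ mdist p (f t) = t.
  move=> [y My yt]; rewrite /f; case: xgetP => [z _ [Mz zt]//|].
  by move=> /(_ y); case.
exists I, f; split.
- move=> _ _ [y My <-] [z Mz <-] r /andP[yr rz].
  have [|x xz xr] := @cutpoint_point z r.
    by rewrite rz andbT; apply: le_trans yr; exact: mdist_ge0.
  exists x => //; apply: (upM _ _ My).
  apply: cutpoint_le_mdist _ xz _; last by rewrite xr.
  by apply: leM => //; exact: le_trans yr rz.
- exists (mdist p a), (mdist p b); split; first by exists a.
    by exists b => //; exact: upM ab.
  rewrite -subr_gt0 -(cutpoint_mdist ab) mdist_gt0; exact/eqP.
- split.
  + by move=> t /fP[].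
  + move=> s t; rewrite !inE => /fP[_ fs] /fP[_ ft] E.
    by rewrite -fs -ft E.
  + move=> y My; have Iy : I (mdist p y) by exists y.
    exists (mdist p y) => //; have [My' yy'] := fP _ Iy.
    by apply: cutpoint_antisym; apply: leM => //; rewrite yy'.
- move=> s t /fP[Ms fs] /fP[Mt ft]; split=> [/cutpoint_mdist_le|st].
    by rewrite fs ft.
  by apply: leM => //; rewrite fs ft.
Qed.

Lemma antichain_cover A : antichain le A ->
  exists A1 A2 A3, [/\ A `<=` A1 `|` A2 `|` A3, A1 #<= branching le,
    A2 #<= terminal le & A3 #<= twig le R].
Proof.
move=> Aanti.
have below_le S : A `&` [set a | exists2 b, S b & le a b] #<= S.
  apply/card_le_relP; exists (fun a b => le a b); split.
    by move=> a [_ [b Sb ab]]; exists b.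
  move=> a a' b [Aa _] [Aa' _] ab a'b.
  by apply: (antichain_eq Aanti) => //; exact: cutpoint_forest ab a'b.
exists (A `&` [set a | exists2 b, branching le b & le a b]),
  (A `&` [set a | exists2 b, terminal le b & le a b]),
  (A `&` [set a | exists2 B, twig le R B & B a]); split => //.
  move=> a Aa.
  have [|nbr] := pselect (exists2 b, branching le b & le a b); first by left; left.
  have [|nte] := pselect (exists2 b, terminal le b & le a b); first by left; right.
  right; split => //; apply: up_chain_twig => [|y z ay az].
    apply: contrapT => /forallNP noab; apply: nte; exists a; last exact: cutpoint_refl.
    by apply/terminalP => b ab; apply: contrapT => nab; exact: (noab b).
  (* The meet of two incomparable points above [a] is a branching node above [a]. *)
  apply: contrapT => /not_orP[nyz nzy].
  have [w [wy wz meetw]] := cutpoint_meet y z.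
  apply: nbr; exists w; last exact: meetw.
  apply/branchingP; exists y, z; split.
  - by split => // E; apply: nyz; rewrite -E.
  - by split => // E; apply: nzy; rewrite -E.
  - by move=> [u [[wu nwu] /meetw uw /uw /(cutpoint_antisym wu)]].
apply/card_le_relP; exists (fun a B => B a /\ twig le R B); split.
  by move=> a [_ [B tB Ba]]; exists B.
move=> a a' B [Aa _] [Aa' _] [Ba tB] [Ba' _].
by apply: (antichain_eq Aanti) => //; exact: twig_total tB _ _.
Qed.

Lemma sphere_antichain (r : R) : antichain le [set x | mdist p x = r].
Proof.
apply: antichainP => x y /= xr yr nxy xy; apply: nxy.
by apply: mdist_positivity; rewrite (cutpoint_mdist xy) xr yr subrr.
Qed.

(** Moving slightly from a point towards the root reaches a rational distance; the root itself has
    distance 0. *)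
Lemma dense_rational_spheres :
  dense [set x | exists q : rat, mdist p x = ratr q].
Proof.
move=> O [x Ox] oO.
have /nbhs_ballP[e /= e0 eO] : nbhs x O by exact: open_nbhs_nbhs.
have [xp|xp] := pselect (x = p).
  by exists x; split => //; exists 0; rewrite xp mdistxx rmorph0.
have px0 : 0 < mdist p x by rewrite mdist_gt0; apply/eqP => /esym.
have [q] : exists q : rat, ratr q \in `](Num.max 0 (mdist p x - e)), (mdist p x)[.
  by apply: rat_in_itvoo; rewrite gt_max px0 ltrBlDr ltrDl.
rewrite in_itv /= gt_max => /andP[/andP[q0 qe] qx].
have [|z zx pz] := @cutpoint_point x (ratr q).
  by rewrite !ltW.
exists z; split; last by exists q.
apply: eO; rewrite ballEmdist /= metric_sym (cutpoint_mdist zx) pz.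
lra.
Qed.

End root.

End Rtree.

(** * Sizes below an uncountable cardinal *)

Lemma card_ltP T K (A : set T) :
  card_lt A [set: K] <-> ~ ([set: K] #<= A).
Proof.
split=> [[]//|nKA]; split => //.
by have [|/nKA] := card_le_total A [set: K].
Qed.

Section uncountable.
Context {K : Type}.
Hypothesis K_uncountable : ~ countable [set: K].

Lemma uncountable_infinite T (A : set T) : [set: K] #<= A -> infinite_set A.
Proof.
move=> KA /finite_set_countable Ac; apply: K_uncountable.
exact: card_le_trans KA Ac.
Qed.

Lemma card_lt_le T U (A : set T) (B : set U) :
  A #<= B -> card_lt B [set: K] -> card_lt A [set: K].
Proof.
by move=> AB /card_ltP nKB; apply/card_ltP => KA; apply/nKB/card_le_trans/AB.
Qed.

(** The larger set absorbs the union when infinite; a finite union is smaller than the uncountable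
    [K]. *)
Lemma card_lt_setU T (A B : set T) : card_lt A [set: K] -> card_lt B [set: K] ->
  card_lt (A `|` B) [set: K].
Proof.
wlog AB : A B / A #<= B => [W|] ltA ltB.
  have [AB|BA] := card_le_total A B; first exact: W.
  by rewrite setUC; exact: W.
have [Bfin|Binf] := pselect (finite_set B).
  apply/card_ltP => /uncountable_infinite; apply; rewrite finite_setU; split => //.
  exact: card_le_finite AB Bfin.
by apply: card_lt_le ltB; exact: card_leU.
Qed.

Lemma card_lt_setX T (A : set T) : card_lt A [set: K] ->
  card_lt (A `*` A) [set: K].
Proof.
move=> ltA; have [Afin|Ainf] := pselect (finite_set A).
  apply/card_ltP => /uncountable_infinite; apply; exact: finite_setX.
by apply: card_lt_le ltA; exact: card_leXX.
Qed.

Lemma card_lt_countable T (A : set T) : countable A -> card_lt A [set: K].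
Proof.
move=> Ac; apply/card_ltP => KA; apply: K_uncountable.
exact: card_le_trans KA Ac.
Qed.

Lemma chain_condition_card_lt X (le : X -> X -> Prop) A :
  chain_condition le K -> antichain le A -> card_lt A [set: K].
Proof.
move=> cc Aanti; apply/card_ltP => /card_le_subset_eq[Z ZA]; apply: cc.
by move=> x y /ZA Ax /ZA Ay; exact: Aanti.
Qed.

End uncountable.

(** * Separability, wispiness and the chain condition *)

Theorem theorem6p9 (R : realType) (X : metricType R) (K : Type) :
  Rtree X -> ~ countable [set: K] ->
  [<-> separable_below X K /\ card_lt (@noncut X) [set: K];
       forall p : X, wispy (cutpoint_le p) R K /\
                     card_lt (terminal (cutpoint_le p)) [set: K];
       forall p : X, chain_condition (cutpoint_le p) K].
Proof.
move=> tX uncK; tfae.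
- move=> [[D densD ltD] ltnc] p; split; first split.
  + apply: card_lt_le (branching_card_le tX p densD) _; exact: card_lt_setX.
  + exact: card_lt_le (twig_card_le tX p densD) ltD.
  + exact: card_lt_le (subset_card_le (@terminal_noncut _ _ tX p)) ltnc.
- move=> wispyX p A Aanti; have [[ltb lttw] ltt] := wispyX p.
  have [A1 [A2 [A3 [Acover A1b A2t A3tw]]]] := antichain_cover tX Aanti.
  have /card_ltP : card_lt A [set: K].
    apply: card_lt_le (subset_card_le Acover) _.
    apply: card_lt_setU => //; last exact: card_lt_le lttw.
    by apply: card_lt_setU => //; [exact: card_lt_le ltb|exact: card_lt_le ltt].
  by move=> nKA; rewrite card_eq_le => /andP[_ /nKA].
(* An empty space offers no root, so its separability is checked directly. *)
- move=> ccX; have [[p _]|/forallNP noX] := pselect (exists p : X, True); last first.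
    have X0 (A : set X) : card_lt A [set: K].
      apply: card_lt_countable => //; suff -> : A = set0 by exact: countable0.
      by rewrite -subset0 => x; have := noX x.
    split; last exact: X0.
    by exists set0; [move=> O [x]; have := noX x|exact: X0].
  split; last first.
    apply: card_lt_le (subset_card_le (@noncut_terminal _ _ tX p)) _.
    apply: card_lt_setU => //; last by apply: card_lt_countable => //; exact: countable1.
    apply: chain_condition_card_lt (ccX p) _ => //.
    apply: antichainP => x y /terminalP xmax _ nxy /xmax.
    exact: nxy.
  exists [set x | exists q : rat, mdist p x = ratr q].
    exact: dense_rational_spheres.
  (* The spheres are enumerated through codes of rationals; a number coding none gets the empty
     antichain. *)
  pose E n : set X := if unpickle n is Some q then [set x | mdist p x = ratr (q : rat)]
    else set0.
  have Eanti n : antichain (cutpoint_le p) (E n).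
    by rewrite /E; case: unpickle => [q|x y //]; exact: sphere_antichain.
  apply: (@card_lt_le _ _ _ _ (\bigcup_n E n)).
    apply: subset_card_le => x [q xq]; exists (pickle q) => //.
    by rewrite /E pickleK.
  apply/card_ltP => KE.
  have [||C Canti] := antichain_of_countable_cover _ _ Eanti uncK KE.
  + exact: cutpoint_trans.
  + exact: cutpoint_forest.
  by have /card_ltP := chain_condition_card_lt (ccX p) Canti.
Qed.
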